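(* Let $1<p,q<\infty$ and $\theta\ge 0$. If $f\in W(L^{p),\theta},L^{q),\theta})(\Omega)$ and $g\in W(L^{p),\theta},L^{q),\theta})'(\Omega)$ (the associate space), then $fg$ is integrable and $$\int_\Omega f(x)\,g(x)\,d\mu(x)\le \|f\|_{W(L^{p),\theta},L^{q),\theta})}\,\|g\|_{W(L^{p),\theta},L^{q),\theta})'}.$$
   Context: $\Omega$ is a locally compact Hausdorff space with a finite Borel measure $\mu$, and $Q\subset\Omega$ is a fixed compact subset with nonempty interior. To make sense of translates, $\Omega$ is a locally compact Borel subset (possibly all) of a locally compact Hausdorff abelian group $G$, written additively; for $x\in\Omega$, $Q+x=\{t+x:t\in Q\}$ and $\chi_{Q+x}$ is the characteristic function of $(Q+x)\cap\Omega$ on $\Omega$. Functions are identified when equal $\mu$-a.e. Generalized grand Lebesgue space: for $1<p<\infty$, $\theta\ge0$, $L^{p),\theta}=L^{p),\theta}(\mu)$ is the space of measurable $f$ with $\|f\|_{p),\theta}=\sup_{0<\varepsilon\le p-1}\varepsilon^{\frac{\theta}{p-\varepsilon}}\left(\int_\Omega|f|^{p-\varepsilon}d\mu\right)^{\frac1{p-\varepsilon}}<\infty$. $(L^{p),\theta})_{loc}$ is the space of measurable $f$ with $f\chi_K\in L^{p),\theta}$ for every compact $K\subset\Omega$. Grand Wiener amalgam space: for $1<p,q<\infty$ and $\theta\ge0$, $W(L^{p),\theta},L^{q),\theta})(\Omega)$ is the space of $f\in(L^{p),\theta})_{loc}$ such that $F_f^{p),\theta}(x)=\|f\chi_{Q+x}\|_{p),\theta}$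 lies in $L^{q),\theta}$, with norm $\|f\|_{W(L^{p),\theta},L^{q),\theta})}=\|F_f^{p),\theta}\|_{q),\theta}$. Associate space: let $\mathcal{M}_0(\Omega)$ be the set of all real-valued measurable functions on $\Omega$ that are finite a.e. Put $\|g\|_{W(L^{p),\theta},L^{q),\theta})'}=\sup\left\{\int_\Omega|fg|\,d\mu: f\in\mathcal{M}_0(\Omega),\ \|f\|_{W(L^{p),\theta},L^{q),\theta})}\le1\right\}$; the associate space $W(L^{p),\theta},L^{q),\theta})'(\Omega)$ is the set of $g\in\mathcal{M}_0(\Omega)$ for which this is finite. *)

(* Defs.v *)
From HB Require Import structures.
From mathcomp Require Import all_boot all_order all_algebra.
From mathcomp Require Import all_classical all_reals all_analysis.
From mathcomp Require Import measurable_realfun.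

Set Implicit Arguments.
Unset Strict Implicit.
Unset Printing Implicit Defensive.

Import Order.TTheory GRing.Theory Num.Theory.
Import numFieldNormedType.Exports.

Local Open Scope classical_set_scope.
Local Open Scope ring_scope.

(* The subset [A] of [X] as a type, with the subspace topology and the Borel
   sigma-algebra of that topology. The point [x0] is there only because a
   [measurableType] must be pointed; nothing else depends on it. *)
Definition borel_subset (X : topologicalType) (A : set X) (x0 : A) : Type :=
  set_type A.

Section borel_subset_instances.
Context (X : topologicalType) (A : set X) (x0 : A).

HB.instance Definition _ := Topological.copy (borel_subset x0) (set_type A).
HB.instance Definition _ := isPointed.Build (borel_subset x0) x0.
HB.instance Definition _ := Measurable.copy (borel_subset x0)
  (g_sigma_algebraType (@open (borel_subset x0))).

End borel_subset_instances.

Section grand_lebesgue.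
Context {d} {T : measurableType d} {R : realType}.
Variables (mu : {measure set T -> \bar R}) (p theta : R).
Local Open Scope ereal_scope.

(* Functions are extended-real-valued because the local norms
   [amalgam_local_norm] below may be infinite at some points. *)
Definition grand_norm (h : T -> \bar R) : \bar R :=
  ereal_sup [set (e `^ (theta / (p - e)))%:E * 'N[mu]_(p - e)%:E[h]
            | e in [set e : R | (0 < e <= p - 1)%R]].

Definition grand_lebesgue : set (T -> \bar R) :=
  [set h : T -> \bar R | measurable_fun [set: T] h /\ grand_norm h < +oo].

End grand_lebesgue.

Section grand_amalgam.
Context {R : realType} {G : topologicalZmodType} {Omega : set G} {x0 : Omega}.
Local Notation T := (borel_subset x0).
Variables (mu : {measure set T -> \bar R}) (Q : set T) (p q theta : R).
Local Open Scope ereal_scope.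

(* [(Q + x) `&` Omega], the addition being that of [G] *)
Definition translate (x : T) : set T :=
  set_val @^-1` [set (set_val t + set_val x)%R | t in Q].

Definition grand_lebesgue_loc : set (T -> R) :=
  [set f : T -> R | measurable_fun [set: T] f /\
    forall K : set T, compact K ->
      grand_lebesgue mu p theta (EFin \o (f \* \1_K)%R)].

Definition amalgam_local_norm (f : T -> R) (x : T) : \bar R :=
  grand_norm mu p theta (EFin \o (f \* \1_(translate x))%R).

Definition grand_amalgam : set (T -> R) :=
  [set f | grand_lebesgue_loc f /\
    grand_lebesgue mu q theta (amalgam_local_norm f)].

(* meaningful for [f] in [grand_amalgam] only *)
Definition amalgam_norm (f : T -> R) : \bar R :=
  grand_norm mu q theta (amalgam_local_norm f).

(* The norm is [+oo] outside the space, hence the condition [grand_amalgam f];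
   it implies that [f] is measurable. *)
Definition associate_norm (g : T -> R) : \bar R :=
  ereal_sup [set \int[mu]_x `|f x * g x|%:E
            | f in [set f | grand_amalgam f /\ amalgam_norm f <= 1]].

Definition associate_space : set (T -> R) :=
  [set g : T -> R | measurable_fun [set: T] g /\ associate_norm g < +oo].

End grand_amalgam.

(* Main.v *)
Require Import Defs.
From HB Require Import structures.
From mathcomp Require Import all_boot all_order all_algebra.
From mathcomp Require Import all_classical all_reals all_analysis.
From mathcomp Require Import measurable_realfun.
Import Order.TTheory GRing.Theory Num.Theory.
Import numFieldNormedType.Exports.
Local Open Scope classical_set_scope.
Local Open Scope ring_scope.

(** The statement is the Hölder inequality that every associate space has, and
    it rests on the homogeneity of the amalgam norm alone. Write [N] for the
    amalgam norm of [f], [A] for the associate norm of [g] and [I] for the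
    integral of [|f g|]. For each real [r > N], the function [f / r] lies in the
    unit ball over which [A] is a supremum, whence [I <= r A]
    ([le_integral_associate_norm]); letting [r] decrease to [N] gives
    [I <= N A]. Working with [r > N] instead of dividing by [N] covers the case
    [N = 0] without having to know that [f] then vanishes almost everywhere.

    Homogeneity is inherited step by step: from the integral to the Lebesgue
    norms ([Lnorm_pZl]), to their weighted supremum ([grand_norm_pZl]), to the
    local norms over the translates of [Q], and finally to the amalgam norm
    ([amalgam_norm_pZl]). *)

Section positive_homogeneity.
Context {d} {T : measurableType d} {R : realType}.
Variable mu : {measure set T -> \bar R}.
Local Open Scope ereal_scope.

Import HBNNSimple.

(** The integral of a nonnegative function is the supremum of the integrals of
    the simple functions below it, and scaling by [c] matches the simple
    functions below [f] with those below [c f]. Being about all nonnegative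
    functions, the lemma scales the restrictions of a function to the translates
    of [Q] without a study of the measurability of these translates. *)
Lemma ge0_integral_pZl (f : T -> \bar R) (c : R) : (0 < c)%R ->
  (forall x, 0 <= f x) -> \int[mu]_x (c%:E * f x) = c%:E * \int[mu]_x f x.
Proof.
have ge_scale (h : T -> \bar R) (k : R) : (0 < k)%R -> (forall x, 0 <= h x) ->
    k%:E * \int[mu]_x h x <= \int[mu]_x (k%:E * h x).
  move=> k0 h0; have kh0 x : 0 <= k%:E * h x.
    by rewrite mule_ge0// lee_fin ltW.
  rewrite !ge0_integralTE// -ereal_sup_pZl//.
  apply/ereal_supP => _ /= [_ [s sh <-] <-].
  apply: ereal_sup_ubound; exists (scale_nnsfun s (ltW k0)).
    by move=> x /=; rewrite EFinM lee_pmul2l.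
  by rewrite -sintegralrM.
move=> c0 f0; apply/eqP; rewrite eq_le ge_scale// andbT.
have cf0 x : 0 <= c%:E * f x by rewrite mule_ge0// lee_fin ltW.
rewrite -lee_pdivrMl//; apply: le_trans (ge_scale _ _ _ cf0) _.
  by rewrite invr_gt0.
under eq_integral do rewrite muleA -EFinM mulVf ?gt_eqF// mul1e.
by [].
Qed.

Lemma Lnorm_pZl (r c : R) (h : T -> \bar R) : (0 < r)%R -> (0 < c)%R ->
  Lnorm mu r%:E (fun x => c%:E * h x) = c%:E * 'N[mu]_r%:E[h].
Proof.
move=> r0 c0; rewrite unlock /Lnorm.
under eq_integral => x _ do
  rewrite abseM gee0_abs ?lee_fin ?(ltW c0)// poweRM ?lee_fin ?(ltW c0)//
    poweR_EFin.
rewrite ge0_integral_pZl ?powR_gt0//; last by move=> x; exact: poweR_ge0.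
rewrite poweRM ?lee_fin ?powR_ge0//; last first.
  by apply: integral_ge0 => x _; exact: poweR_ge0.
by rewrite poweR_EFin -powRrM divff ?gt_eqF// powRr1// ltW.
Qed.

(** Only exponents [p - e >= 1] enter the supremum, so [Lnorm_pZl] applies. *)
Lemma grand_norm_pZl (p theta c : R) (h : T -> \bar R) : (0 < c)%R ->
  grand_norm mu p theta (fun x => c%:E * h x) =
  c%:E * grand_norm mu p theta h.
Proof.
move=> c0; rewrite /grand_norm -ereal_sup_pZl// image_comp.
congr ereal_sup; apply: eq_imagel => e /= /andP[_ ep].
rewrite Lnorm_pZl//; first by rewrite muleCA.
by rewrite subr_gt0; apply: le_lt_trans ep _; rewrite ltrBlDr ltrDl.
Qed.

Lemma grand_norm_ge0 (p theta : R) (h : T -> \bar R) : (1 < p)%R ->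
  0 <= grand_norm mu p theta h.
Proof.
move=> p1; apply: ereal_sup_ge => /=.
eexists; first by exists (p - 1)%R => //=; rewrite subr_gt0 p1 lexx.
by rewrite mule_ge0// ?lee_fin ?powR_ge0//; exact: Lnorm_ge0.
Qed.

Lemma grand_lebesgue_pZl (p theta c : R) (h : T -> \bar R) : (0 < c)%R ->
  grand_lebesgue mu p theta h ->
  grand_lebesgue mu p theta (fun x => c%:E * h x).
Proof.
move=> c0 [mh hoo]; split; first exact: measurable_funeM.
by rewrite grand_norm_pZl// lte_mul_pinfty// lee_fin ltW.
Qed.

End positive_homogeneity.

Section amalgam.
Context {R : realType} {G : topologicalZmodType} {Omega : set G} {x0 : Omega}.
Local Notation T := (borel_subset x0).
Variables (mu : {measure set T -> \bar R}) (Q : set T) (p q theta : R).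
Local Open Scope ereal_scope.

Lemma scale_indicE (c : R) (f : T -> R) (A : set T) :
  EFin \o ((fun x => c * f x)%R \* \1_A)%R =
  fun x => c%:E * (EFin \o (f \* \1_A)%R) x.
Proof. by apply/funext => x /=; rewrite -EFinM mulrA. Qed.

Lemma amalgam_local_norm_pZl (c : R) (f : T -> R) : (0 < c)%R ->
  amalgam_local_norm mu Q p theta (fun x => c * f x)%R =
  fun x => c%:E * amalgam_local_norm mu Q p theta f x.
Proof.
move=> c0; apply/funext => x.
by rewrite /amalgam_local_norm scale_indicE grand_norm_pZl.
Qed.

Lemma amalgam_norm_pZl (c : R) (f : T -> R) : (0 < c)%R ->
  amalgam_norm mu Q p q theta (fun x => c * f x)%R =
  c%:E * amalgam_norm mu Q p q theta f.
Proof.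
by move=> c0; rewrite /amalgam_norm amalgam_local_norm_pZl// grand_norm_pZl.
Qed.

Lemma grand_amalgam_pZl (c : R) (f : T -> R) : (0 < c)%R ->
  grand_amalgam mu Q p q theta f ->
  grand_amalgam mu Q p q theta (fun x => c * f x)%R.
Proof.
move=> c0 [[mf floc] Ff]; split; last first.
  by rewrite amalgam_local_norm_pZl//; exact: grand_lebesgue_pZl.
split; first exact: measurable_funM.
by move=> K cK; rewrite scale_indicE; apply: grand_lebesgue_pZl => //; exact: floc.
Qed.

(** The function [f / r] is admissible in the supremum that defines the
    associate norm as soon as [r] dominates the norm of [f]. *)
Lemma le_integral_associate_norm (f g : T -> R) (r : R) : (0 < r)%R ->
  grand_amalgam mu Q p q theta f -> amalgam_norm mu Q p q theta f <= r%:E ->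
  \int[mu]_x `|f x * g x|%:E <= r%:E * associate_norm mu Q p q theta g.
Proof.
move=> r0 hf fr; have ri0 : (0 < r^-1)%R by rewrite invr_gt0.
rewrite -lee_pdivrMl// -ge0_integral_pZl//.
apply: ereal_sup_ubound; exists (fun x => r^-1 * f x)%R => /=.
  split; first exact: grand_amalgam_pZl.
  by rewrite amalgam_norm_pZl// lee_pdivrMl// mule1.
by apply: eq_integral => x _; rewrite -mulrA normrM (gtr0_norm ri0) EFinM.
Qed.

End amalgam.

Theorem theorem4 (R : realType) (G : topologicalZmodType)
    (hG : hausdorff_space G) (lcG : locally_compact [set: G])
    (Omega : set G) (x0 : Omega)
    (borelO : <<s @open G >> Omega)
    (lcO : locally_compact [set: borel_subset x0])
    (mu : {finite_measure set (borel_subset x0) -> \bar R})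
    (Q : set (borel_subset x0))
    (cQ : compact Q) (Q0 : interior Q !=set0)
    (p q theta : R) (p1 : 1 < p) (q1 : 1 < q) (theta0 : 0 <= theta)
    (f g : borel_subset x0 -> R)
    (hf : grand_amalgam mu Q p q theta f)
    (hg : associate_space mu Q p q theta g) :
  mu.-integrable [set: borel_subset x0] (fun x => (f x * g x)%:E) /\
  (\int[mu]_x (f x * g x)%:E <=
    amalgam_norm mu Q p q theta f * associate_norm mu Q p q theta g)%E.
Proof.
have [[mf _] [_ Noo]] := hf; have [mg Aoo] := hg.
have mfg : measurable_fun [set: borel_subset x0] (fun x => (f x * g x)%:E).
  by apply/measurable_EFinP; exact: measurable_funM.
have le_I (r : R) (r0 : 0 < r) :=
  le_integral_associate_norm mu Q p q theta f g r r0 hf.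
rewrite -/(amalgam_norm mu Q p q theta f) in Noo.
have N0 : (0 <= amalgam_norm mu Q p q theta f)%E by exact: grand_norm_ge0.
move: N0 Noo le_I; case: amalgam_norm => // n; rewrite lee_fin => n0 _ le_I.
have I0 : (0 <= \int[mu]_x `|f x * g x|%:E)%E by exact: integral_ge0.
have A0 : (0 <= associate_norm mu Q p q theta g)%E.
  have r0 : 0 < n + 1 by rewrite ltr_wpDl.
  have := le_I _ r0; rewrite lee_fin lerDl => /(_ ler01) /(le_trans I0).
  by rewrite pmule_rge0.
move: A0 Aoo le_I; case: associate_norm => // a; rewrite lee_fin => a0 _ le_I.
have le_Ina : (\int[mu]_x `|f x * g x|%:E <= n%:E * a%:E)%E.
  apply/lee_addgt0Pr => e e0.
  have a1 : 0 < a + 1 by rewrite ltr_wpDl.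
  (* [n] is increased by an amount whose product with [a] is at most [e]; the
     denominator is [a + 1] because [a] may vanish *)
  have s0 : 0 < e / (a + 1) by rewrite divr_gt0.
  apply: le_trans (le_I (n + e / (a + 1)) _ _) _.
  - by rewrite ltr_wpDl.
  - by rewrite lee_fin lerDl ltW.
  - rewrite -!EFinM -EFinD lee_fin mulrDl lerD2l mulrAC ler_pdivrMr//.
    by rewrite ler_pM2l// lerDl.
split.
  by apply/integrableP; split => //; exact: le_lt_trans le_Ina (ltry _).
apply: le_trans le_Ina; apply: le_trans (lee_abs _) _.
exact: le_abse_integral.
Qed.
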